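(* Let $X,Y$ be independent random variables with distribution functions $F,G\in\mathcal{F}$, respectively, and let $Z$ be a mixture of $X$ and $Y$ with parameter $p\in(0,1)$. (a) If $X,Y\in\mathcal{J}$, then the following are equivalent: (i) $(X\vee Y)\in\mathcal{J}$; (ii) $(X+Y)\in\mathcal{J}$; (iii) $Z\in\mathcal{J}$. (b) If $X,Y\in\mathcal{J}$, then $(X\wedge Y)\in\mathcal{J}$.
   Context: Let $\mathcal{F}$ be the set of all distribution functions of nonnegative random variables with unbounded support. A random variable is said to belong to a class of distribution functions if its distribution function does. $X\vee Y$ and $X\wedge Y$ are the pointwise maximum and minimum. A random variable $Z$ is a mixture of $X$ and $Y$ with parameter $p\in(0,1)$ if its distribution function is $pF+(1-p)G$. The class $\mathcal{J}$ is the set of all $F\in\mathcal{F}$ such that, for $X_1,X_2,\ldots$ i.i.d. with distribution function $F$ and for all $n\ge2$, $$\lim_{K\to\infty}\liminf_{x\to\infty}\frac{\mathbb{P}(\max(X_1,\ldots,X_n)>x-K,\;X_1+\cdots+X_n>x)}{\mathbb{P}(X_1+\cdots+X_n>x)}=1.$$ *)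

(* Defs.v *)
From HB Require Import structures.
From mathcomp Require Import all_boot all_order all_algebra.
From mathcomp Require Import all_classical all_reals all_analysis.
From mathcomp Require Import measurable_realfun.

Set Implicit Arguments.
Unset Strict Implicit.
Unset Printing Implicit Defensive.

Import Order.TTheory GRing.Theory Num.Theory.
Import numFieldNormedType.Exports.

Local Open Scope classical_set_scope.
Local Open Scope ring_scope.

Section independence.
Context d (T : measurableType d) (R : realType) (P : probability T R).

Definition independent (X Y : {RV P >-> R}) : Prop :=
  forall A B : set R, measurable A -> measurable B ->
    P (X @^-1` A `&` Y @^-1` B) = (P (X @^-1` A) * P (Y @^-1` B))%E.

Definition mutually_independent (I : finType) (X : I -> {RV P >-> R}) : Prop :=
  forall (J : {set I}) (A : I -> set R), (forall i, measurable (A i)) ->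
    P (\bigcap_(i in [set` J]) X i @^-1` A i) =
    (\prod_(i in J) P (X i @^-1` A i))%E.

Definition support (X : {RV P >-> R}) : set R :=
  [set x | forall U : set R, open U -> U x -> (0 < distribution P X U)%E].

End independence.

Section classes.
Context (R : realType).

(* Distribution functions have the type of the library's cdf, which is
   extended-real valued. *)
Definition classF : set (R -> \bar R) :=
  [set F | exists (d : measure_display) (T : measurableType d)
             (P : probability T R) (X : {RV P >-> R}),
     [/\ cdf X = F, forall w, 0 <= X w & ~ bounded_set (support X)]].

(* P(max(X_1, .., X_n) > x - K, X_1 + .. + X_n > x) / P(X_1 + .. + X_n > x).
   The maximum is taken in \bar R only to have -oo as neutral element. When the
   X_i are i.i.d. with distribution function in classF the denominator is
   positive for every x. *)
Definition big_jump_ratio d (T : measurableType d) (P : probability T R)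
    (n : nat) (X : 'I_n -> {RV P >-> R}) (K x : R) : R :=
  fine (P [set w | ((x - K)%:E < \big[maxe/-oo]_(i < n) (X i w)%:E)%E /\
                   x < \sum_(i < n) X i w]) /
  fine (P [set w | x < \sum_(i < n) X i w]).

(* For each n only the first n terms of the i.i.d. sequence matter, so n i.i.d.
   random variables on an arbitrary probability space are considered; the
   quotient depends on their common distribution function only, and such
   variables always exist (coordinates on a product space). *)
Definition classJ : set (R -> \bar R) :=
  [set F | classF F /\
    forall n : nat, (2 <= n)%N ->
    forall (d : measure_display) (T : measurableType d)
      (P : probability T R) (X : 'I_n -> {RV P >-> R}),
      mutually_independent X -> (forall i, cdf (X i) = F) ->
      limf_einf (fun x : R => (big_jump_ratio X K x)%:E) +oo
        @[K --> +oo] --> 1%:E].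

End classes.

(* Main.v *)
From HB Require Import structures.
Require Import Defs.
From mathcomp Require Import all_boot all_order all_algebra.
From mathcomp Require Import all_classical all_reals all_analysis.
From mathcomp Require Import measurable_realfun.
From mathcomp Require Import ring lra.

Set Implicit Arguments.
Unset Strict Implicit.
Unset Printing Implicit Defensive.

Import Order.TTheory GRing.Theory Num.Theory.
Import numFieldNormedType.Exports.

Local Open Scope classical_set_scope.
Local Open Scope ring_scope.

(** The quotient in the definition of the class and its double limit, for every
    number of summands, are first replaced by one inequality between tails.  Write
    [tail mu x] for the mass of the law [mu] beyond [x] and [joint_tail mu mu K x]
    for the probability that two independent variables with law [mu] both exceed
    [K] and have a sum beyond [x].  A law of a nonnegative unbounded variable is in
    the class if and only if for every [e > 0] there is [K] such that, for all [x],
    [joint_tail mu mu K x <= e * tail mu x] ([single_big_jump], [classJP]).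

    One direction uses two summands only.  It needs that shifting the argument of
    the tail by a constant costs at most a constant factor, which follows by
    comparing the sum with the event that the two summands exceed [L] and [x - L]
    ([single_big_jump_two]).  In the other direction, because the inequality holds
    for all [x] it can be integrated over the remaining summands
    ([joint_excess_le]): two given summands among [n] being large is negligible
    against the sum being large.  If the sum exceeds [x] and no summand comes close
    to [x], two summands must be large ([two_large_summands]).

    The inequality involves the law only through its tail: products of laws are
    monotone in the tails on all the events concerned
    ([product_tail_dominated]).  Hence the class is invariant under two-sided
    comparison of tails up to constants ([single_big_jump_tail_equiv]).  The tails
    of the maximum and of the mixture are both comparable to the sum of the tails
    of [X] and [Y], and so is the tail of [X + Y] as soon as one of the three laws
    is in the class ([single_big_jump_sum]).  This gives part (a).

    For part (b), the tail of the minimum is the product of the two tails.  If two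
    independent copies of the minimum exceed [K] and add up to more than [x], then
    so do the two copies of [X] and, independently, the two copies of [Y], whence
    the joint tail of the minimum is at most the product of the joint tails
    ([joint_tail_min]). *)

(** * Probabilities as real numbers, and independent pairs *)

Section real_valued_probability.
Context d (T : measurableType d) (R : realType) (P : probability T R).
Implicit Types A B C : set T.

Definition prob A : R := fine (P A).

Lemma probE A : measurable A -> (prob A)%:E = P A.
Proof. by move=> mA; rewrite /prob fineK// fin_num_measure. Qed.

Lemma prob_ge0 A : 0 <= prob A.
Proof. exact: fine_ge0. Qed.

Lemma le_prob A B : measurable A -> measurable B -> A `<=` B ->
  prob A <= prob B.
Proof. by move=> mA mB AB; rewrite -lee_fin !probE// le_measure ?inE. Qed.

Lemma prob_le1 A : measurable A -> prob A <= 1.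
Proof. by move=> mA; rewrite -lee_fin probE// probability_le1. Qed.

Lemma probT : prob setT = 1.
Proof. by rewrite /prob probability_setT. Qed.

Lemma prob_leU A B C : measurable A -> measurable B -> measurable C ->
  A `<=` B `|` C -> prob A <= prob B + prob C.
Proof.
move=> mA mB mC ABC; rewrite -lee_fin EFinD !probE//.
apply: (@le_trans _ _ (P (B `|` C))); last exact: measureU2.
by apply: le_measure; rewrite ?inE//; exact: measurableU.
Qed.

Lemma prob_setD A B : measurable A -> measurable B -> B `<=` A ->
  prob (A `\` B) = prob A - prob B.
Proof.
move=> mA mB BA; apply/eqP; rewrite eq_sym subr_eq eq_sym; apply/eqP/EFin_inj.
have mD : measurable (A `\` B) by exact: measurableD.
by rewrite EFinD !probE// (measureDI P mA mB) setIC setIidl.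
Qed.

Lemma prob_le_bigU A (I : eqType) (s : seq I) (p : pred I) (F : I -> set T) :
  measurable A -> (forall i, measurable (F i)) ->
  (forall w, A w -> exists i, [/\ i \in s, p i & F i w]) ->
  prob A <= \sum_(i <- s | p i) prob (F i).
Proof.
elim: s A => [|i s IH] A mA mF AF.
  rewrite big_nil (_ : A = set0) ?/prob ?measure0//.
  by rewrite -subset0 => w /AF[j []].
rewrite big_cons; case: ifPn => [pi|npi]; last first.
  apply: IH => // w /AF[j []]; rewrite inE => /predU1P[->|js] pj Fj.
    by rewrite pj in npi.
  by exists j.
have : prob (A `\` F i) <= \sum_(j <- s | p j) prob (F j).
  apply: IH => //; first exact: measurableD.
  move=> w [/AF[j []]]; rewrite inE => /predU1P[->//|js] pj Fj _.
  by exists j.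
rewrite -(lerD2l (prob (F i))); apply: le_trans; apply: prob_leU => //.
  exact: measurableD.
by move=> w Aw; case: (pselect (F i w)) => ?; [left|right].
Qed.

(** Random variables with a nonnegative law are nonnegative only almost surely;
    the null set on which they are negative enters comparisons of events as
    [N]. *)
Lemma le_prob_ae A B N : measurable A -> measurable B -> measurable N ->
  prob N = 0 -> A `<=` B `|` N -> prob A <= prob B.
Proof. by move=> mA mB mN N0 /prob_leU; rewrite N0 addr0; apply. Qed.

End real_valued_probability.

Lemma prob_product (R : realType) d1 d2 (T1 : measurableType d1)
    (T2 : measurableType d2) (P1 : probability T1 R) (P2 : probability T2 R)
    A B : measurable A -> measurable B ->
  prob (P1 \x P2)%E (A `*` B) = prob P1 A * prob P2 B.
Proof.
move=> mA mB; apply: EFin_inj.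
by rewrite EFinM !probE//; [exact: product_measure1E|exact: measurableX].
Qed.

(** Fibrewise comparison of two product laws with a common first factor,
    by integrating over that factor. *)
Lemma prob_product_dominated (R : realType) d0 d1 d2 (T0 : measurableType d0)
    (T1 : measurableType d1) (T2 : measurableType d2) (P0 : probability T0 R)
    (P1 : probability T1 R) (P2 : probability T2 R)
    (A : set (T0 * T1)) (B : set (T0 * T2)) (c : R) :
  measurable A -> measurable B -> 0 <= c ->
  (forall t, prob P1 (xsection A t) <= c * prob P2 (xsection B t)) ->
  prob (P0 \x P1)%E A <= c * prob (P0 \x P2)%E B.
Proof.
move=> mA mB c0 AB; rewrite -lee_fin EFinM !probE//.
rewrite /= /product_measure1 -ge0_integralZl//; last first.
  exact: measurable_fun_xsection.
apply: ge0_le_integral => //.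
- exact: measurable_fun_xsection.
- by apply: emeasurable_funM => //; exact: measurable_fun_xsection.
- move=> t _ /=; have := AB t; rewrite -lee_fin EFinM !probE//;
  exact: measurable_xsection.
Qed.

(** Uniqueness of product measures, relative to an event: independence on
    rectangles extends to all events about the pair. *)
Lemma prob_indep_pair (R : realType) d d1 d2 (T : measurableType d)
    (T1 : measurableType d1) (T2 : measurableType d2) (P : probability T R)
    (P1 : probability T1 R) (P2 : probability T2 R)
    (U : T -> T1) (V : T -> T2) (D : set T) :
  measurable D -> measurable_fun setT U -> measurable_fun setT V ->
  (forall A B, measurable A -> measurable B ->
    prob P (D `&` (U @^-1` A `&` V @^-1` B)) =
    prob P D * (prob P1 A * prob P2 B)) ->
  forall C, measurable C ->
    prob P (D `&` [set w | C (U w, V w)]) = prob P D * prob (P1 \x P2)%E C.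
Proof.
move=> mD mU mV UV C mC.
have mUV : measurable_fun setT (fun w => (U w, V w)).
  exact: measurable_fun_pair.
pose f w := (U w, V w).
pose m0 : {measure set (T1 * T2) -> \bar R} := pushforward (mrestr P mD) f.
pose m' := m0 mUV.
pose k : {nonneg R} := NngNum (prob_ge0 P D).
have m'E A B : measurable A -> measurable B ->
    m' (A `*` B) = (mscale k P1 A * P2 B)%E.
  move=> mA mB; rewrite /m' /= /pushforward /mrestr /mscale /=.
  have -> : f @^-1` (A `*` B) `&` D = D `&` (U @^-1` A `&` V @^-1` B).
    by rewrite setIC.
  rewrite -!probE//; first by rewrite UV// !EFinM muleA.
  apply: measurableI => //; apply: measurableI.
    by rewrite -[X in measurable X]setTI; exact: mU.
  by rewrite -[X in measurable X]setTI; exact: mV.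
have := product_measure_unique m'E mC.
rewrite /m' /= /pushforward /mrestr /= {1}/product_measure1.
rewrite ge0_integral_mscale//; last exact: measurable_fun_xsection.
move=> E; apply: EFin_inj; rewrite EFinM probE; last first.
  apply: measurableI => //; rewrite -[X in measurable X]setTI; exact: (mUV).
by rewrite setIC -E (probE _ mC).
Qed.

(** * Tails of sums of two independent variables *)

Section tails.
Context (R : realType).
Implicit Types (mu nu rho sigma : probability R R) (x y K : R).

Definition tail mu x : R := prob mu `]x, +oo[.

Definition sum_gt x : set (R * R) := [set ab | x < ab.1 + ab.2].

Definition both_gt K x : set (R * R) :=
  [set ab | [/\ K < ab.1, K < ab.2 & x < ab.1 + ab.2]].

Lemma measurable_sum_gt x : measurable (sum_gt x).
Proof.
have mf : measurable_fun setT (fun ab : R * R => ab.1 + ab.2).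
  by apply: measurable_funD; [exact: measurable_fst|exact: measurable_snd].
rewrite (_ : sum_gt x = setT `&` (fun ab => ab.1 + ab.2) @^-1` `]x, +oo[).
  exact: mf.
by apply/seteqP; split=> ab; rewrite /sum_gt /= in_itv /= andbT // => -[].
Qed.

Lemma both_gtE K x : both_gt K x = (`]K, +oo[ `*` `]K, +oo[) `&` sum_gt x.
Proof.
apply/seteqP; split=> ab; rewrite /both_gt /sum_gt /= !in_itv /= !andbT.
  by case.
by case=> -[].
Qed.

Lemma measurable_both_gt K x : measurable (both_gt K x).
Proof.
rewrite both_gtE; apply: measurableI; last exact: measurable_sum_gt.
exact: measurableX.
Qed.

Lemma tail_ge0 mu x : 0 <= tail mu x. Proof. exact: prob_ge0. Qed.

Lemma tail_le1 mu x : tail mu x <= 1.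
Proof. by apply: prob_le1. Qed.

Lemma tail_nonincreasing mu x y : x <= y -> tail mu y <= tail mu x.
Proof.
move=> xy; apply: le_prob => // z /=; rewrite !in_itv /= !andbT.
exact: le_lt_trans.
Qed.

Lemma tail_small mu (e : R) : 0 < e -> exists K, tail mu K <= e.
Proof.
move=> e0.
pose X : {RV mu >-> R} := HB.pack (idfun : R -> R)
  (isMeasurableFun.Build _ _ R R idfun (@measurable_id _ R setT)).
have c0 : ccdf X @ +oo --> 0%E by exact: cvg_ccdfy0.
have /fine_cvgP[_ /cvgrPdist_le /(_ _ e0)] := c0.
case=> M [_ HM]; exists (M + 1); have := HM (M + 1).
rewrite /= sub0r normrN ger0_norm; last exact: fine_ge0.
by apply; rewrite ltrDl.
Qed.

Lemma prob_product_sym mu nu (E : set (R * R)) : measurable E ->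
  (forall a b, E (a, b) -> E (b, a)) ->
  prob (mu \x nu)%E E = prob (nu \x mu)%E E.
Proof.
move=> mE Esym.
have := @prob_indep_pair R _ _ _ _ _ _ (mu \x nu)%E nu mu snd fst setT
  measurableT measurable_snd measurable_fst.
move=> /(_ _ _ mE); rewrite probT mul1r setTI => <-.
  congr prob; apply/seteqP; split=> -[a b] /=; exact: Esym.
move=> A B mA mB; rewrite setTI mul1r mulrC -prob_product//.
by congr prob; apply/seteqP; split=> -[a b] /= [].
Qed.

Definition ray_sections (E : set (R * R)) :=
  forall a, xsection E a = set0 \/ exists t, xsection E a = `]t, +oo[%classic.

Lemma ray_sections_sum_gt x : ray_sections (sum_gt x).
Proof.
move=> a; right; exists (x - a); apply/seteqP; split=> b;
by rewrite /xsection /sum_gt /= inE /= in_itv /= andbT ltrBlDl.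
Qed.

Lemma ray_sections_both_gt K x : ray_sections (both_gt K x).
Proof.
move=> a; have [Ka|aK] := ltP K a; [right|left].
  exists (Num.max K (x - a)); apply/seteqP; split=> b;
  rewrite /xsection /both_gt /= inE /= in_itv /= andbT gt_max ltrBlDl.
    by case=> _ -> ->.
  by case/andP.
rewrite -subset0 => b; rewrite /xsection /both_gt /= inE /= => -[Ka _ _].
by move: (lt_le_trans Ka aK); rewrite ltxx.
Qed.

(** Replace one factor at a time, fibre by fibre: on a set whose sections are
    upper rays the fibre probabilities are tails, and the symmetry of the set
    exchanges the roles of the two factors. *)
Lemma product_tail_dominated mu1 mu2 nu1 nu2 (E : set (R * R)) (c1 c2 : R) :
  measurable E -> (forall a b, E (a, b) -> E (b, a)) -> ray_sections E ->
  0 <= c1 -> 0 <= c2 ->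
  (forall x, tail nu1 x <= c1 * tail mu1 x) ->
  (forall x, tail nu2 x <= c2 * tail mu2 x) ->
  prob (nu1 \x nu2)%E E <= c1 * c2 * prob (mu1 \x mu2)%E E.
Proof.
move=> mE Esym rE c10 c20 H1 H2.
have right_dom (lam mu nu : probability R R) c : 0 <= c ->
    (forall x, tail nu x <= c * tail mu x) ->
    prob (lam \x nu)%E E <= c * prob (lam \x mu)%E E.
  move=> c0 H; apply: prob_product_dominated => // a.
  case: (rE a) => [->|[t ->]]; last exact: H.
  by rewrite /prob !measure0 /= mulr0.
apply: le_trans (right_dom _ _ _ _ c20 H2) _.
rewrite -mulrA mulrCA ler_wpM2l// prob_product_sym//.
rewrite [in leRHS]prob_product_sym//; exact: right_dom.
Qed.

Definition conv_tail mu nu x : R := prob (mu \x nu)%E (sum_gt x).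

Definition joint_tail mu nu K x : R := prob (mu \x nu)%E (both_gt K x).

Lemma conv_tail_dominated mu1 mu2 nu1 nu2 (c1 c2 : R) x :
  0 <= c1 -> 0 <= c2 ->
  (forall x, tail nu1 x <= c1 * tail mu1 x) ->
  (forall x, tail nu2 x <= c2 * tail mu2 x) ->
  conv_tail nu1 nu2 x <= c1 * c2 * conv_tail mu1 mu2 x.
Proof.
move=> c10 c20 H1 H2; apply: product_tail_dominated => //.
- exact: measurable_sum_gt.
- by move=> a b; rewrite /sum_gt /= addrC.
- exact: ray_sections_sum_gt.
Qed.

Lemma joint_tail_dominated mu1 mu2 nu1 nu2 (c1 c2 : R) K x :
  0 <= c1 -> 0 <= c2 ->
  (forall x, tail nu1 x <= c1 * tail mu1 x) ->
  (forall x, tail nu2 x <= c2 * tail mu2 x) ->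
  joint_tail nu1 nu2 K x <= c1 * c2 * joint_tail mu1 mu2 K x.
Proof.
move=> c10 c20 H1 H2; apply: product_tail_dominated => //.
- exact: measurable_both_gt.
- by move=> a b; rewrite /both_gt /= addrC => -[].
- exact: ray_sections_both_gt.
Qed.

Lemma joint_tail_nonincreasing mu nu K K' x : K <= K' ->
  joint_tail mu nu K' x <= joint_tail mu nu K x.
Proof.
move=> KK; apply: le_prob; try exact: measurable_both_gt.
by move=> ab [/= a b s]; split=> //=; exact: le_lt_trans KK _.
Qed.

Lemma joint_tail_le_tail mu nu K x : joint_tail mu nu K x <= tail mu K.
Proof.
rewrite -[leRHS]mulr1 -(probT nu) -prob_product//.
apply: le_prob; [exact: measurable_both_gt|exact: measurableX|].
by move=> ab [/= a b s]; rewrite in_itv /= a.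
Qed.

(** Unless both summands exceed [K], one of them is at most [K] and the other one
    exceeds [x - K]. *)
Lemma conv_tail_le mu nu K x :
  conv_tail mu nu x <= joint_tail mu nu K x + (tail mu (x - K) + tail nu (x - K)).
Proof.
have mX1 : measurable (`]x - K, +oo[ `*` setT : set (R * R)).
  exact: measurableX.
have mX2 : measurable (setT `*` `]x - K, +oo[ : set (R * R)).
  exact: measurableX.
have <- : prob (mu \x nu)%E (`]x - K, +oo[ `*` setT) = tail mu (x - K).
  by rewrite prob_product// probT mulr1.
have <- : prob (mu \x nu)%E (setT `*` `]x - K, +oo[) = tail nu (x - K).
  by rewrite prob_product// probT mul1r.
apply: (@le_trans _ _ (joint_tail mu nu K x +
    prob (mu \x nu)%E (`]x - K, +oo[ `*` setT `|` setT `*` `]x - K, +oo[))).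
  apply: prob_leU.
  - exact: measurable_sum_gt.
  - exact: measurable_both_gt.
  - exact: measurableU.
  move=> [a b]; rewrite /sum_gt /both_gt /= !in_itv /= !andbT => s.
  case: (ltP K a) => Ka; last by right; right; split=> //; lra.
  case: (ltP K b) => Kb; last by right; left; split=> //; lra.
  by left.
by rewrite lerD2l; apply: prob_leU => //; exact: measurableU.
Qed.

(** The property behind the class, stripped of limits and of the number of
    summands.  The bound is required at every threshold [x] and not only for
    large ones, which makes it stable under convolution with further summands;
    nothing is lost, since on a bounded range of [x] it holds as soon as [K] is
    large. *)
Definition single_big_jump mu := forall e : R, 0 < e ->
  exists K, forall x, joint_tail mu mu K x <= e * tail mu x.

(** If one summand exceeds [L] and the other one [x - L] then both are large and
    the sum exceeds [x].  So the tail at [x - L], times the positive constant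
    [tail mu L], is at most the joint tail, hence at most the tail at [x]. *)
Lemma tail_shift mu : (forall x, 0 < tail mu x) -> single_big_jump mu ->
  forall k, exists2 C : R, 0 <= C & forall x, tail mu (x - k) <= C * tail mu x.
Proof.
move=> mu0 /(_ 1 ltr01)[K HK] k.
pose L := Num.max K k.
have LK : K <= L by rewrite le_max lexx.
have Lk : k <= L by rewrite le_max lexx orbT.
exists ((tail mu L)^-1 + (tail mu (K + L))^-1).
  by rewrite addr_ge0// invr_ge0 ltW.
move=> x; have [xL|xL] := leP (K + L) x.
  apply: (@le_trans _ _ ((tail mu L)^-1 * tail mu x)); last first.
    by rewrite ler_wpM2r ?tail_ge0// lerDl invr_ge0 ltW.
  rewrite mulrC ler_pdivlMr//.
  apply: (@le_trans _ _ (tail mu L * tail mu (x - L))).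
    rewrite mulrC ler_wpM2l ?tail_ge0//; apply: tail_nonincreasing.
    by rewrite lerD2l lerN2.
  apply: le_trans (_ : joint_tail mu mu K x <= _); last first.
    by rewrite -[leRHS]mul1r.
  rewrite -prob_product//; apply: le_prob => //.
  - exact: measurableX.
  - exact: measurable_both_gt.
  move=> [a b]; rewrite /both_gt /= !in_itv /= !andbT => -[La Lb].
  by split; lra.
apply: (@le_trans _ _ ((tail mu (K + L))^-1 * tail mu x)); last first.
  by rewrite ler_wpM2r ?tail_ge0// lerDr invr_ge0 ltW.
rewrite mulrC ler_pdivlMr//; apply: le_trans (_ : tail mu (K + L) <= _).
  by rewrite ler_piMl ?tail_ge0 ?tail_le1.
by rewrite tail_nonincreasing// ltW.
Qed.

Lemma conv_tail_le_tail mu : (forall x, 0 < tail mu x) -> single_big_jump mu ->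
  exists2 C : R, 0 <= C & forall x, conv_tail mu mu x <= C * tail mu x.
Proof.
move=> mu0 sbj; have [K HK] := sbj 1 ltr01.
have [C C0 HC] := tail_shift mu0 sbj K.
exists (1 + (C + C)); first by lra.
move=> x; apply: le_trans (conv_tail_le _ _ K _) _.
by rewrite !mulrDl !lerD.
Qed.

(** Invariance under weak tail equivalence: passing from [mu] to [nu] costs a
    factor [C] for each of the two summands, and passing back in the upper bound
    costs a factor [c]. *)
Lemma single_big_jump_tail_equiv mu nu (c C : R) : 0 <= c -> 0 <= C ->
  (forall x, tail nu x <= C * tail mu x) ->
  (forall x, tail mu x <= c * tail nu x) ->
  single_big_jump mu -> single_big_jump nu.
Proof.
move=> c0 C0 numu munu sbj e e0.
have d0 : 0 < C * C * c + 1 by rewrite ltr_wpDl// !mulr_ge0.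
have [K HK] := sbj _ (divr_gt0 e0 d0).
exists K => x; apply: le_trans (joint_tail_dominated K x C0 C0 numu numu) _.
apply: (@le_trans _ _ (C * C * (e / (C * C * c + 1) * tail mu x))).
  by rewrite ler_wpM2l// mulr_ge0.
apply: (@le_trans _ _ (C * C * (e / (C * C * c + 1) * (c * tail nu x)))).
  rewrite ler_wpM2l ?mulr_ge0// ler_wpM2l ?munu//.
  by rewrite divr_ge0// ltW.
have -> : C * C * (e / (C * C * c + 1) * (c * tail nu x)) =
    (C * C * c / (C * C * c + 1)) * (e * tail nu x) by ring.
rewrite ler_piMl ?mulr_ge0 ?tail_ge0 ?(ltW e0)//.
by rewrite ler_pdivrMr// mul1r lerDl.
Qed.

(** [sigma] is the law of the sum and [rho] any law whose tail is comparable to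
    the sum of the two tails, such as that of the maximum or of a mixture.  As
    [rho] has a lighter tail than [sigma] up to a constant, weak tail equivalence
    reduces both implications to [tail sigma <= M * tail rho].  If [rho] has the
    property, the convolution of [mu] and [nu] is dominated by that of [rho] with
    itself, hence by [rho].  If [sigma] has it, the part of [tail sigma] where
    both summands are large is at most half of [tail sigma] and can be absorbed,
    and the rest is bounded by shifted tails of [mu] and [nu]. *)
Lemma single_big_jump_sum mu nu rho sigma (c C : R) : 0 <= c -> 0 <= C ->
  (forall x, 0 < tail mu x) -> (forall x, 0 < tail nu x) ->
  single_big_jump mu -> single_big_jump nu ->
  (forall x, tail mu x <= tail sigma x) ->
  (forall x, tail nu x <= tail sigma x) ->
  (forall x, tail sigma x = conv_tail mu nu x) ->
  (forall x, tail rho x <= C * (tail mu x + tail nu x)) ->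
  (forall x, tail mu x + tail nu x <= c * tail rho x) ->
  single_big_jump rho <-> single_big_jump sigma.
Proof.
move=> c0 C0 mu0 nu0 sbjmu sbjnu musig nusig sigE rhoC rhoc.
have rhosig x : tail rho x <= C * 2 * tail sigma x.
  apply: le_trans (rhoC x) _; rewrite -mulrA ler_wpM2l// mulrDl mul1r.
  by rewrite lerD.
have murho x : tail mu x <= c * tail rho x.
  by apply: le_trans (rhoc x); rewrite lerDl tail_ge0.
have nurho x : tail nu x <= c * tail rho x.
  by apply: le_trans (rhoc x); rewrite lerDr tail_ge0.
have rho0 x : 0 < tail rho x.
  have := lt_le_trans (mu0 x) (murho x); have := tail_ge0 rho x.
  by rewrite le_eqVlt => /predU1P[<-|//]; rewrite mulr0 ltxx.
have conclude (M : R) : 0 <= M -> (forall x, tail sigma x <= M * tail rho x) ->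
    single_big_jump rho <-> single_big_jump sigma.
  move=> M0 sigrho; have C20 : 0 <= C * 2 by rewrite mulr_ge0.
  split; first exact: (single_big_jump_tail_equiv C20 M0 sigrho rhosig).
  exact: (single_big_jump_tail_equiv M0 C20 rhosig sigrho).
split=> [sbjrho|sbjsig].
  have [M M0 HM] := conv_tail_le_tail rho0 sbjrho.
  apply/(conclude (c * c * M)) => //; first by rewrite !mulr_ge0.
  move=> x; rewrite sigE -mulrA.
  apply: le_trans (conv_tail_dominated x c0 c0 murho nurho) _.
  by rewrite ler_wpM2l ?mulr_ge0.
have half0 : 0 < 2^-1 :> R by rewrite invr_gt0.
have [K HK] := sbjsig _ half0.
have [M M0 HM] := tail_shift mu0 sbjmu K.
have [N N0 HN] := tail_shift nu0 sbjnu K.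
apply/(conclude (2 * ((M + N) * c))) => //; first by rewrite !mulr_ge0 ?addr_ge0.
move=> x.
have Hj : joint_tail mu nu K x <= 2^-1 * tail sigma x.
  apply: le_trans (HK x); rewrite -[leRHS]mul1r -[1]mulr1.
  by apply: joint_tail_dominated => // y; rewrite mul1r.
have := conv_tail_le mu nu K x; rewrite -sigE.
have HMx := HM x; have HNx := HN x.
have HM' : M * tail mu x <= M * (c * tail rho x) by rewrite ler_wpM2l.
have HN' : N * tail nu x <= N * (c * tail rho x) by rewrite ler_wpM2l.
lra.
Qed.

End tails.

(** * Nonnegative laws with unbounded support *)

Section support_of_law.
Context d (T : measurableType d) (R : realType) (P : probability T R).
Variable X : {RV P >-> R}.

Local Notation mu := (distribution P X).

Lemma tail_cdf x : (tail mu x)%:E = (1 - cdf X x)%E.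
Proof. by rewrite /tail probE//; exact: (ccdf_1_cdf X x). Qed.

(** Let [t] grow from [M] as long as the law has no mass between [M] and [t]; the
    supremum of these [t] is in the support, because every neighbourhood of it
    contains points beyond it. *)
Lemma support_beyond : (forall x, 0 < tail mu x) ->
  forall M : R, exists2 y, M <= y & Defs.support X y.
Proof.
move=> mu0 M.
pose S := [set t : R | M <= t /\ prob mu `]M, t] = 0].
have SM : S M by split=> //; rewrite set_itv_ge ?bnd_simp ?ltxx// /prob measure0.
have [K HK] : exists K, tail mu K <= tail mu M / 2.
  by apply: tail_small; rewrite divr_gt0.
have SK : ubound S K.
  move=> t [Mt t0]; rewrite leNgt; apply/negP => Kt.
  have : tail mu M <= prob mu `]M, t] + tail mu t.
    apply: prob_leU => // z /=; rewrite !in_itv /= !andbT => Mz.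
    by case: (leP z t) => zt; [left|right]; rewrite ?Mz.
  rewrite t0 add0r => /le_trans/(_ (tail_nonincreasing mu (ltW Kt))).
  move=> /le_trans/(_ HK); rewrite ler_pdivlMr// leNgt => /negP; apply.
  by rewrite ltr_pMr// ltr1n.
have supS : has_sup S by split; [exists M|exists K].
have My : M <= sup S by apply: ub_le_sup => //; exists K.
exists (sup S) => // U oU Uy.
have [e /= e0 eU] : nbhs_ball (sup S) U by rewrite nbhs_ballE; exact: open_nbhs_nbhs.
have mU : measurable U by exact: open_measurable.
have [t [Mt t0] St] := sup_adherent e0 supS.
rewrite lt_neqAle measure_ge0 andbT; apply/eqP => /esym/(congr1 fine) U0.
(* [`]M, sup S + e / 2]] is covered by [`]M, t]] and [U], so if [U] were null
   the supremum could be exceeded. *)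
have : S (sup S + e / 2).
  split; first by rewrite (le_trans My)// lerDl divr_ge0// ltW.
  apply/eqP; rewrite eq_le prob_ge0 andbT.
  have -> : 0 = prob mu `]M, t] + prob mu U by rewrite t0 add0r -[LHS]U0.
  apply: prob_leU => // z /=; rewrite !in_itv /= => /andP[Mz ze].
  case: (leP z t) => zt; first by left; rewrite Mz.
  right; apply: eU; rewrite /ball /= ltr_norml; apply/andP; split; lra.
move/(ub_le_sup (ex_intro _ K SK)); rewrite gerDl leNgt => /negP; apply.
by rewrite divr_gt0.
Qed.

Lemma bounded_support (x : R) : (forall w, 0 <= X w) -> tail mu x = 0 ->
  bounded_set (Defs.support X).
Proof.
move=> X0 x0; rewrite /bounded_set /bounded_near; near=> M.
move=> y Xy /=; have y0 : 0 <= y.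
  rewrite leNgt; apply/negP => y0.
  have : (0 < P (X @^-1` `]-oo, 0%R[))%E.
    by apply: Xy; [exact: interval_open|rewrite /= in_itv].
  rewrite (_ : _ @^-1` _ = set0) ?measure0 ?ltxx//.
  by rewrite -subset0 => w /=; rewrite in_itv /= ltNge X0.
have yx : y <= x.
  rewrite leNgt; apply/negP => xy.
  have : (0 < mu `]x, +oo[)%E.
    by apply: Xy; [exact: interval_open|rewrite /= in_itv /= xy].
  by rewrite -probE// -/(tail mu x) x0 ltxx.
rewrite ger0_norm//; apply: le_trans yx _.
by near: M; apply: nbhs_pinfty_ge; exact: num_real.
Unshelve. all: by end_near. Qed.

End support_of_law.

Section cdf_in_classF.
Context d (T : measurableType d) (R : realType) (P : probability T R).

(** Continuity from below along [- 1 / n]: the distribution function vanishing at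
    each negative point makes their union null. *)
Lemma cdf_neg_null (X : {RV P >-> R}) : (forall r, r < 0 -> cdf X r = 0%E) ->
  prob (distribution P X) `]-oo, 0[ = 0.
Proof.
move=> X0; apply/eqP; rewrite -eqe probE//; apply/eqP.
have -> : `]-oo, (0 : R)[%classic =
    \bigcup_n `]-oo, (- n.+1%:R^-1 : R)]%classic.
  apply/seteqP; split=> x /=; rewrite in_itv /=.
    move=> x0; have /ltr_add_invr[n] : 0 < - x by rewrite oppr_gt0.
    rewrite add0r => nx; exists n => //=.
    by rewrite in_itv /= lerNr ltW.
  by move=> [n _] /=; rewrite in_itv /= => /le_lt_trans; apply; rewrite oppr_lt0.
apply: measure_negligible; first exact: bigcupT_measurable.
apply: negligible_bigcup => n; apply/negligibleP => //.
by apply: X0; rewrite oppr_lt0.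
Qed.

(** A distribution function does not see whether a variable with that
    distribution is negative on a null set, hence the almost sure form; in the
    converse direction the positive part of [X] is the nonnegative witness. *)
Lemma classFP (X : {RV P >-> R}) : classF (cdf X) <->
  prob (distribution P X) `]-oo, 0[ = 0 /\
  forall x, 0 < tail (distribution P X) x.
Proof.
split.
  case=> d' [T' [P' [X' [cdfE X'0 Xunb]]]]; split.
    apply: cdf_neg_null => r r0; rewrite -cdfE /cdf.
    rewrite /distribution /pushforward (_ : _ @^-1` _ = set0) ?measure0//.
    rewrite -subset0 => w /=; rewrite in_itv /= leNgt => /negP; apply.
    by rewrite (lt_le_trans r0).
  move=> x; rewrite lt_neqAle tail_ge0 andbT; apply/eqP => /esym x0.
  apply: Xunb; apply: (@bounded_support _ _ _ _ _ x) => //.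
  by apply: EFin_inj; rewrite tail_cdf cdfE -tail_cdf x0.
move=> [neg0 pos].
have mN : measurable (X @^-1` `]-oo, 0[) by exact: measurable_funPTI.
pose X' : {RV P >-> R} := X \max (cst 0 : {mfun T >-> R}).
have cdfE : cdf X' = cdf X.
  apply/funext => r; rewrite /cdf /distribution /pushforward.
  have [r0|r0] := ltP r 0.
    rewrite (_ : X' @^-1` _ = set0) ?measure0; last first.
      rewrite -subset0 => w /=; rewrite in_itv /= ge_max => /andP[_].
      by rewrite leNgt r0.
    apply/esym/eqP; rewrite eq_le measure_ge0 andbT.
    have <- : P (X @^-1` `]-oo, 0%R[) = 0%E.
      by change (distribution P X `]-oo, 0%R[ = 0%E); rewrite -probE// neg0.
    rewrite le_measure ?inE//; first exact: measurable_funPTI.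
    by move=> w /=; rewrite !in_itv /= => /le_lt_trans; apply.
  congr (P _); apply/seteqP; split=> w /=; rewrite !in_itv /= ge_max.
    by case/andP.
  by move=> ->.
exists d, T, P, X'; split => //.
  by move=> w; rewrite /= le_max lexx orbT.
have pos' x : 0 < tail (distribution P X') x.
  by rewrite -lte_fin tail_cdf cdfE -tail_cdf lte_fin.
move=> [M [_ HM]].
have [y My Xy] := support_beyond pos' (M + 2).
have M1 : M < M + 1 by rewrite ltrDl.
have /= := le_trans (ler_norm y) (HM _ M1 y Xy).
by move=> /(le_trans My); rewrite lerD2l leNgt ltr1n.
Qed.

End cdf_in_classF.

(** * Limit of the lower limits *)

Section limit_of_liminf.
Context (R : realType) (f : R -> R -> R).

Lemma limf_einf_cvg1 : (forall K x, f K x <= 1) ->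
  (forall e : R, 0 < e -> exists K0 : R, forall K, K0 <= K ->
    exists x0 : R, forall x, x0 <= x -> 1 - e <= f K x) ->
  limf_einf (fun x => (f K x)%:E) +oo%R @[K --> +oo] --> 1%:E.
Proof.
move=> f1 fe.
have le1 K : (limf_einf (fun x => (f K x)%:E) +oo%R <= 1%:E)%E.
  rewrite limf_einfE; apply: ge_ereal_sup => _ [V [M [_ MV]] <-].
  apply: (@le_trans _ _ (f K (M + 1))%:E); last by rewrite lee_fin.
  apply: ereal_inf_lbound; exists (M + 1) => //.
  by apply: MV; rewrite ltrDl.
have ge K (c x0 : R) : (forall x, x0 <= x -> c <= f K x) ->
    (c%:E <= limf_einf (fun x => (f K x)%:E) +oo%R)%E.
  move=> cf; rewrite limf_einfE.
  apply: (@le_trans _ _ (ereal_inf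
      [set (f K x)%:E | x in [set x | x0 < x]])).
    by apply: le_ereal_inf_tmp => _ [x x0x <-]; rewrite lee_fin cf// ltW.
  apply: ereal_sup_ubound; exists [set x | x0 < x] => //.
  exists x0; split=> //; exact: num_real.
have fe1 := fe 1 ltr01.
apply/fine_cvgP; split.
  case: fe1 => K0 HK0; exists K0; split; first exact: num_real.
  move=> K /ltW /HK0[x0 Hx0]; rewrite fin_numElt; apply/andP; split.
    by apply: lt_le_trans (ge _ _ _ Hx0); exact: ltNyr.
  by apply: le_lt_trans (le1 K) _; exact: ltry.
apply/cvgrPdist_le => e e0; have [K0 HK0] := fe e e0.
exists K0; split; first exact: num_real.
move=> K /ltW /HK0[x0 /ge] /=; have := le1 K.
case: (limf_einf _ _) => [r| |] //; rewrite !lee_fin /= => r1 er.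
by rewrite ger0_norm ?subr_ge0// lerBlDr addrC -lerBlDr.
Qed.

Lemma cvg1_limf_einf :
  limf_einf (fun x => (f K x)%:E) +oo%R @[K --> +oo] --> 1%:E ->
  forall e : R, 0 < e -> exists K x0 : R, forall x, x0 <= x -> 1 - e <= f K x.
Proof.
move=> /fine_cvgP[[K1 [_ fin]] /cvgrPdist_lt dist] e e0.
have [K2 [_ HK2]] := dist e e0.
pose K := Num.max K1 K2 + 1.
have K1K : K1 < K by rewrite ltr_pwDr// le_max lexx.
have K2K : K2 < K by rewrite ltr_pwDr// le_max lexx orbT.
exists K; have := HK2 K K2K; have := fin K K1K => /= finK.
have : limf_einf (fun x => (f K x)%:E) +oo%R =
  (fine (limf_einf (fun x => (f K x)%:E) +oo%R))%:E by rewrite fineK.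
move: (fine _) => r rE re.
have : ((1 - e)%:E < limf_einf (fun x => (f K x)%:E) +oo%R)%E.
  rewrite rE lte_fin ltrBlDr -ltrBlDl.
  exact: le_lt_trans (ler_norm _) re.
rewrite limf_einfE => /ereal_sup_gt[_ [V [M [_ MV]] <-]] Vgt.
exists (M + 1) => x Mx; rewrite -lee_fin; apply/ltW/(lt_le_trans Vgt).
apply: ereal_inf_lbound; exists x => //; apply: MV.
by rewrite (lt_le_trans _ Mx)// ltrDl.
Qed.

End limit_of_liminf.

(** * From the limit for two summands to a bound on the joint tail *)

Section from_two_summands.
Context (R : realType).
Implicit Types (mu : probability R R).

Definition one_jump K x : set (R * R) :=
  [set ab | (x - K < ab.1 \/ x - K < ab.2) /\ x < ab.1 + ab.2].

Lemma one_jumpE K x : one_jump K x =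
  (`]x - K, +oo[ `*` setT `|` setT `*` `]x - K, +oo[) `&` sum_gt x.
Proof.
apply/seteqP; split=> -[a b]; rewrite /one_jump /sum_gt /= !in_itv /= !andbT.
  by case=> -[h|h] s; split=> //; [left|right].
by case=> -[[h _]|[_ h]] s; split=> //; [left|right].
Qed.

Lemma measurable_one_jump K x : measurable (one_jump K x).
Proof.
rewrite one_jumpE; apply: measurableI; last exact: measurable_sum_gt.
by apply: measurableU; apply: measurableX.
Qed.

Lemma one_jump_le_tail mu K x :
  prob (mu \x mu)%E (one_jump K x) <= tail mu (x - K) + tail mu (x - K).
Proof.
have {1}-> : tail mu (x - K) = prob (mu \x mu)%E (`]x - K, +oo[ `*` setT).
  by rewrite prob_product// probT mulr1.
have -> : tail mu (x - K) = prob (mu \x mu)%E (setT `*` `]x - K, +oo[).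
  by rewrite prob_product// probT mul1r.
apply: prob_leU; [exact: measurable_one_jump|exact: measurableX..|].
by rewrite one_jumpE => ab [].
Qed.

Lemma tail_mul_le_conv_tail mu L x :
  tail mu L * tail mu (x - L) <= conv_tail mu mu x.
Proof.
rewrite -prob_product//; apply: le_prob; first exact: measurableX.
  exact: measurable_sum_gt.
move=> [a b]; rewrite /sum_gt /= !in_itv /= !andbT => -[La Lb]; lra.
Qed.

(** The hypothesis with [e = 1 / 2] bounds the tail of the sum by four times the
    tail at [x - K1].  Since the sum exceeds [x] when the summands exceed [L] and
    [x - L], with [L] as large as desired, shifting a tail by a constant changes
    it by at most a bounded factor.  After that the tail of the sum is bounded by
    a multiple of the tail, and on the event that both summands exceed [K] either
    none exceeds [x - K2], which has a small probability by hypothesis, or one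
    exceeds [x - K2] while the other exceeds [K], which is negligible because the
    tail at [K] is small. *)
Lemma single_big_jump_two mu : (forall x, 0 < tail mu x) ->
  (forall e : R, 0 < e -> exists K x0 : R, forall x, x0 <= x ->
    (1 - e) * conv_tail mu mu x <= prob (mu \x mu)%E (one_jump K x)) ->
  single_big_jump mu.
Proof.
move=> mu0 H.
have half0 : 0 < 2^-1 :> R by rewrite invr_gt0.
have [K1 [x1 HK1]] := H _ half0.
have conv4 x : x1 <= x -> conv_tail mu mu x <= 4 * tail mu (x - K1).
  move=> /HK1 h; have h' := one_jump_le_tail mu K1 x.
  move: h h'; move: (conv_tail _ _ _) (prob _ _) (tail _ _) => a b c; lra.
have shift k : exists2 C, 0 <= C & forall x, tail mu (x - k) <= C * tail mu x.
  pose L := K1 + k; pose y1 := x1 - K1.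
  exists (4 / tail mu L + (tail mu y1)^-1).
    by rewrite addr_ge0 ?invr_ge0 ?divr_ge0 ?tail_ge0.
  move=> y; rewrite mulrDl; have [yy|yy] := leP y1 y.
    apply: (@le_trans _ _ (4 / tail mu L * tail mu y)); last first.
      by rewrite lerDl mulr_ge0 ?invr_ge0 ?tail_ge0.
    rewrite mulrAC ler_pdivlMr// mulrC.
    have -> : y - k = (y + K1) - L by rewrite /L; ring.
    apply: le_trans (tail_mul_le_conv_tail _ _ _) _.
    have -> : tail mu y = tail mu (y + K1 - K1) by rewrite addrK.
    by apply: conv4; rewrite -lerBlDr.
  apply: (@le_trans _ _ ((tail mu y1)^-1 * tail mu y)); last first.
    by rewrite lerDr mulr_ge0 ?divr_ge0 ?tail_ge0.
  rewrite mulrC ler_pdivlMr//.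
  apply: (@le_trans _ _ (tail mu y1)); last exact/tail_nonincreasing/ltW.
  by rewrite ler_piMl ?tail_ge0 ?tail_le1.
have [C1 C10 HC1] := shift K1.
have conv_le x : x1 <= x -> conv_tail mu mu x <= 4 * C1 * tail mu x.
  move=> /conv4 /le_trans; apply.
  by rewrite -mulrA ler_wpM2l.
move=> e e0.
(* The relative error is chosen so that, after the loss [4 * C1] in [conv_le],
   at most [e / 2] remains. *)
have d0 : 0 < 2 * (4 * C1 + 1) by rewrite mulr_gt0// ltr_wpDl// mulr_ge0.
have [K2 [x2 HK2]] := H _ (divr_gt0 e0 d0).
have [C2 C20 HC2] := shift K2.
pose x3 := Num.max x1 x2.
(* [K3] makes each of the two mixed events contribute at most [e / 4]; [K4] takes
   care of the thresholds below [x3], where the joint tail is only bounded by the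
   tail at [K]. *)
have d20 : 0 < 4 * (C2 + 1) by rewrite mulr_gt0// ltr_wpDl.
have [K3 HK3] := tail_small mu (divr_gt0 e0 d20).
have [K4 HK4] := tail_small mu (mulr_gt0 e0 (mu0 x3)).
pose K := Num.max K3 K4.
have K3K : tail mu K <= e / (4 * (C2 + 1)).
  by apply: le_trans HK3; rewrite tail_nonincreasing// le_max lexx.
have K4K : tail mu K <= e * tail mu x3.
  by apply: le_trans HK4; rewrite tail_nonincreasing// le_max lexx orbT.
exists K => x; have [xx|xx] := leP x3 x; last first.
  apply: le_trans (joint_tail_le_tail _ _ _ _) _; apply: le_trans K4K _.
  by rewrite ler_wpM2l ?(ltW e0)// tail_nonincreasing// ltW.
have x1x : x1 <= x by rewrite (le_trans _ xx)// le_max lexx.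
have x2x : x2 <= x by rewrite (le_trans _ xx)// le_max lexx orbT.
have mO := measurable_one_jump K2 x; have mS := measurable_sum_gt x.
have mX1 : measurable (`]K, +oo[ `*` `]x - K2, +oo[ : set (R * R)).
  exact: measurableX.
have mX2 : measurable (`]x - K2, +oo[ `*` `]K, +oo[ : set (R * R)).
  exact: measurableX.
have mSO : measurable (sum_gt x `\` one_jump K2 x) by exact: measurableD.
have J1 : joint_tail mu mu K x <=
    (conv_tail mu mu x - prob (mu \x mu)%E (one_jump K2 x)) +
    (tail mu K * tail mu (x - K2) + tail mu (x - K2) * tail mu K).
  rewrite -prob_setD//; last by move=> ab [].
  rewrite -!prob_product//.
  apply: (@le_trans _ _ (prob (mu \x mu)%E (sum_gt x `\` one_jump K2 x) +
      prob (mu \x mu)%E (`]K, +oo[ `*` `]x - K2, +oo[ `|`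
                         `]x - K2, +oo[ `*` `]K, +oo[))).
    apply: prob_leU; [exact: measurable_both_gt|by []|exact: measurableU|].
    move=> [a b]; rewrite /both_gt /one_jump /sum_gt /= !in_itv /= !andbT.
    move=> [Ka Kb xab].
    have [xb|xb] := ltP (x - K2) b; first by right; left.
    have [xa|xa] := ltP (x - K2) a; first by right; right.
    by left; split=> // -[[|]]; rewrite ltNge ?xa ?xb.
  by rewrite lerD2l; apply: prob_leU => //; exact: measurableU.
have J2 := HK2 x x2x; have J3 := conv_le x x1x; have J4 := HC2 x.
have J5 : e / (2 * (4 * C1 + 1)) * conv_tail mu mu x <= e / 2 * tail mu x.
  apply: (@le_trans _ _ (e / (2 * (4 * C1 + 1)) * (4 * C1 * tail mu x))).
    by rewrite ler_wpM2l// ltW// divr_gt0.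
  have -> : e / (2 * (4 * C1 + 1)) * (4 * C1 * tail mu x) =
     e / 2 * tail mu x * (4 * C1 / (4 * C1 + 1)).
    by field; rewrite gt_eqF// ltr_wpDl// mulr_ge0.
  rewrite ler_piMr//; first by rewrite mulr_ge0 ?tail_ge0// divr_ge0// ltW.
  by rewrite ler_pdivrMr ?mul1r ?lerDl// ltr_wpDl// mulr_ge0.
have J6 : tail mu K * tail mu (x - K2) <= e / 4 * tail mu x.
  apply: (@le_trans _ _ (e / (4 * (C2 + 1)) * (C2 * tail mu x))).
    by rewrite ler_pM ?tail_ge0.
  have -> : e / (4 * (C2 + 1)) * (C2 * tail mu x) =
     e / 4 * tail mu x * (C2 / (C2 + 1)).
    by field; rewrite gt_eqF// ltr_wpDl.
  rewrite ler_piMr//; first by rewrite mulr_ge0 ?tail_ge0// divr_ge0// ltW.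
  by rewrite ler_pdivrMr ?mul1r ?lerDl// ltr_wpDl.
apply: le_trans J1 _; rewrite (mulrC (tail mu (x - K2))).
move: J2 J5 J6; rewrite mulrBl mul1r.
set a := conv_tail _ _ _; set b := prob _ _; set c := tail mu K * _.
set g := tail mu x; set h := _ * a; move: a b c g h => a b c g h; lra.
Qed.

(** The coordinates on the plane with the product law are the two independent
    copies to which the class applies. *)
Lemma classJ_two d (T : measurableType d) (P : probability T R)
    (X : {RV P >-> R}) (mu := distribution P X) : classJ (cdf X) ->
  forall e : R, 0 < e -> exists K x0 : R, forall x, x0 <= x ->
    (1 - e) * conv_tail mu mu x <= prob (mu \x mu)%E (one_jump K x).
Proof.
move=> [/classFP[_ mu0] /(_ 2 isT) HJ].
pose X1 : {RV (mu \x mu)%E >-> R} := HB.pack (fst : R * R -> R)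
  (isMeasurableFun.Build _ _ (R * R)%type R fst measurable_fst).
pose X2 : {RV (mu \x mu)%E >-> R} := HB.pack (snd : R * R -> R)
  (isMeasurableFun.Build _ _ (R * R)%type R snd measurable_snd).
pose Xs (i : 'I_2) := if i == ord0 then X1 else X2.
have indep : mutually_independent Xs.
  move=> J A mA; pose B i := if i \in J then A i else setT.
  have mB i : measurable (B i) by rewrite /B; case: ifP.
  have -> : \bigcap_(i in [set` J]) Xs i @^-1` A i =
      B ord0 `*` B (lift ord0 ord0).
    apply/seteqP; split=> [ab HA|[a b] [/= Ha Hb] i /= iJ].
      split; rewrite /B; case: ifPn => // iJ.
        exact: (HA ord0).
      exact: (HA (lift ord0 ord0)).
    rewrite /Xs; move: iJ; case: (unliftP ord0 i) => [j ->|->] => [|iJ].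
      by rewrite (ord1 j) => iJ; move: Hb; rewrite /B iJ.
    by move: Ha; rewrite /B iJ.
  rewrite [LHS]product_measure1E// big_mkcond big_ord_recl big_ord_recl big_ord0.
  rewrite [in RHS]/= mule1.
  rewrite /B /Xs /=; congr (_ * _)%E.
    case: ifPn => [_|_]; last by rewrite probability_setT.
    rewrite [X in _ = _ X](_ : _ = A ord0 `*` setT); last first.
      by apply/seteqP; split=> -[a b] //= [].
    by rewrite [RHS]product_measure1E// [X in (_ * X)%E]probability_setT mule1.
  case: ifPn => [_|_]; last by rewrite probability_setT.
  rewrite [X in _ = _ X](_ : _ = setT `*` A (lift ord0 ord0)); last first.
    by apply/seteqP; split=> -[a b] //= [].
  by rewrite [RHS]product_measure1E// [X in (X * _)%E]probability_setT mul1e.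
have cdfE i : cdf (Xs i) = cdf X.
  apply/funext => r; rewrite /Xs; case: ifPn => _.
    rewrite /cdf {1}/distribution /pushforward.
    rewrite (_ : _ @^-1` _ = `]-oo, r] `*` setT); last first.
      by apply/seteqP; split=> -[a b] //= [].
    by rewrite [LHS]product_measure1E// [X in (_ * X)%E]probability_setT mule1.
  rewrite /cdf {1}/distribution /pushforward.
  rewrite (_ : _ @^-1` _ = setT `*` `]-oo, r]); last first.
    by apply/seteqP; split=> -[a b] //= [].
  by rewrite [LHS]product_measure1E// [X in (X * _)%E]probability_setT mul1e.
have Hlim := HJ _ _ _ Xs indep cdfE.
move=> e e0; have [K [x0 Hx]] := cvg1_limf_einf Hlim e0.
exists K, x0 => x x0x; have := Hx x x0x.
rewrite /big_jump_ratio.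
have sumE ab : \sum_(i < 2) Xs i ab = ab.1 + ab.2.
  by rewrite big_ord_recl big_ord_recl big_ord0 addr0.
have -> : [set w | x < \sum_(i < 2) Xs i w] = sum_gt x.
  by apply/seteqP; split=> ab; rewrite /sum_gt /= sumE.
have -> : [set w | ((x - K)%:E < \big[maxe/-oo]_(i < 2) (Xs i w)%:E)%E /\
    x < \sum_(i < 2) Xs i w] = one_jump K x.
  have maxE ab : ((x - K)%:E < \big[maxe/-oo]_(i < 2) (Xs i ab)%:E)%E =
      (x - K < ab.1) || (x - K < ab.2).
    by rewrite big_ord_recl big_ord_recl big_ord0 maxeNy lt_max !lte_fin.
  apply/seteqP; split=> ab; rewrite /one_jump /= maxE sumE.
    by move=> [/orP].
  by move=> [/orP].
have c0 : 0 < conv_tail mu mu x.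
  by apply: lt_le_trans (tail_mul_le_conv_tail mu 0 x); rewrite mulr_gt0.
by rewrite ler_pdivlMr.
Qed.

End from_two_summands.

(** * Grouping independent summands *)

Section n_summands.
Context d (T : measurableType d) (R : realType) (P : probability T R).

Lemma measurable_preimage_RV (X : {RV P >-> R}) A : measurable A ->
  measurable (X @^-1` A).
Proof. by move=> mA; exact: measurable_funPTI. Qed.

(** Integrating over the remaining summands [W]: since the bound on the joint
    tail holds at every threshold, it survives the convolution. *)
Lemma joint_excess_le (W U V : {RV P >-> R}) (K x e : R) : 0 <= e ->
  (forall A B C, measurable A -> measurable B -> measurable C ->
    prob P (W @^-1` A `&` (U @^-1` B `&` V @^-1` C)) =
    prob P (W @^-1` A) * (prob P (U @^-1` B) * prob P (V @^-1` C))) ->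
  (forall y, joint_tail (distribution P U) (distribution P V) K y <=
    e * tail (distribution P U) y) ->
  prob P [set w | [/\ K < U w, K < V w & x < W w + (U w + V w)]] <=
  e * prob P [set w | x < W w + U w].
Proof.
move=> e0 indep He.
set lam := distribution P W; set mu := distribution P U in He *.
set nu := distribution P V in He *.
pose E : set (R * (R * R)) :=
  [set t | [/\ K < t.2.1, K < t.2.2 & x < t.1 + (t.2.1 + t.2.2)]].
have mE : measurable E.
  have m21 : measurable_fun setT (fun t : R * (R * R) => t.2.1).
    exact: measurableT_comp measurable_fst measurable_snd.
  have m22 : measurable_fun setT (fun t : R * (R * R) => t.2.2).
    exact: measurableT_comp measurable_snd measurable_snd.
  have ms : measurable_fun setT (fun t : R * (R * R) => t.1 + (t.2.1 + t.2.2)).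
    apply: measurable_funD; first exact: measurable_fst.
    exact: measurable_funD.
  rewrite (_ : E = ((fun t => t.2.1) @^-1` `]K, +oo[ `&`
    (fun t => t.2.2) @^-1` `]K, +oo[) `&`
    (fun t => t.1 + (t.2.1 + t.2.2)) @^-1` `]x, +oo[).
    by do 2?apply: measurableI; rewrite -[X in measurable X]setTI;
      [exact: m21|exact: m22|exact: ms].
  apply/seteqP; split=> t; rewrite /E /= !in_itv /= !andbT.
    by case.
  by move=> [[]].
have mW : measurable_fun setT W by [].
have mU : measurable_fun setT U by [].
have mV : measurable_fun setT V by [].
have UV A C : measurable A -> measurable C ->
    prob P (W @^-1` A `&` [set w | C (U w, V w)]) =
    prob P (W @^-1` A) * prob (mu \x nu)%E C.
  move=> mA mC; apply: (prob_indep_pair _ mU mV) => //.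
    exact: measurable_preimage_RV.
  by move=> B D mB mD; rewrite indep.
have lhsE : prob P [set w | [/\ K < U w, K < V w & x < W w + (U w + V w)]] =
    prob (lam \x (mu \x nu))%E E.
  have := @prob_indep_pair R _ _ _ T R (R * R)%type P lam (mu \x nu)%E W
    (fun w => (U w, V w)) setT measurableT mW (measurable_fun_pair mU mV).
  move=> /(_ _ E mE); rewrite probT mul1r setTI => <- //.
  by move=> A C mA mC; rewrite setTI mul1r; exact: UV.
have rhsE : prob P [set w | x < W w + U w] = prob (lam \x mu)%E (sum_gt x).
  have := @prob_indep_pair R _ _ _ T R R P lam mu W U setT measurableT mW mU.
  move=> /(_ _ _ (measurable_sum_gt x)); rewrite probT mul1r setTI => <- //.
  move=> A B mA mB; rewrite setTI mul1r.
  by have := indep A B setT mA mB measurableT; rewrite preimage_setT setIT probT mulr1.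
rewrite lhsE rhsE; apply: prob_product_dominated => // [|r].
  exact: measurable_sum_gt.
have -> : xsection E r = both_gt K (x - r).
  apply/seteqP; split=> -[a b]; rewrite /xsection /E /both_gt /= inE /=;
  by rewrite ltrBlDl.
have -> : xsection (sum_gt x) r = `]x - r, +oo[%classic.
  apply/seteqP; split=> a; rewrite /xsection /sum_gt /= inE /= in_itv /=;
  by rewrite andbT ltrBlDl.
exact: He.
Qed.

Context (n : nat) (X : 'I_n -> {RV P >-> R}).
Hypothesis indepX : mutually_independent X.

Lemma measurable_sumRV (s : seq 'I_n) :
  measurable_fun setT (fun w => \sum_(k <- s) X k w).
Proof. exact: measurable_sum. Qed.

Definition sumRV (s : seq 'I_n) : {RV P >-> R} :=
  HB.pack (fun w => \sum_(k <- s) X k w)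
    (isMeasurableFun.Build _ _ T R _ (measurable_sumRV s)).

Local Notation box J A := (\bigcap_(i in [set` J]) X i @^-1` A i).

Lemma measurable_box (J : {set 'I_n}) (A : 'I_n -> set R) :
  (forall i, measurable (A i)) -> measurable (box J A).
Proof.
move=> mA; apply: fin_bigcap_measurable => //.
by move=> i _; exact: measurable_preimage_RV.
Qed.

Lemma prob_box (J : {set 'I_n}) (A : 'I_n -> set R) :
  (forall i, measurable (A i)) ->
  prob P (box J A) = \prod_(i in J) prob P (X i @^-1` A i).
Proof.
move=> mA; apply: EFin_inj; rewrite probE; last exact: measurable_box.
rewrite indepX// -prodEFin; apply: eq_bigr => i _.
by rewrite probE//; exact: measurable_preimage_RV.
Qed.

(** Grouping: a partial sum is independent of the variables outside it.  Each
    induction step moves one variable from the box into the sum, through the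
    law of the pair formed by that variable and the shorter sum. *)
Lemma sum_indep_box (s : seq 'I_n) (J : {set 'I_n}) (A : 'I_n -> set R)
    (B : set R) :
  uniq s -> (forall k, k \in s -> k \notin J) ->
  (forall i, measurable (A i)) -> measurable B ->
  prob P (box J A `&` sumRV s @^-1` B) =
  prob P (box J A) * prob P (sumRV s @^-1` B).
Proof.
elim: s J A B => [|k s IH] J A B us sJ mA mB.
  have [B0|B0] := pselect (B 0).
    rewrite (_ : sumRV [::] @^-1` B = setT) ?setIT ?probT ?mulr1//.
    by apply/seteqP; split=> w //= _; rewrite big_nil.
  rewrite (_ : sumRV [::] @^-1` B = set0) ?setI0 /prob ?measure0 ?mulr0//.
  by rewrite -subset0 => w /=; rewrite big_nil.
have /andP[ks us'] := us.
pose C := [set ab : R * R | B (ab.1 + ab.2)].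
have mC : measurable C.
  have mf : measurable_fun setT (fun ab : R * R => ab.1 + ab.2).
    by apply: measurable_funD; [exact: measurable_fst|exact: measurable_snd].
  by rewrite -[C]setTI; exact: mf.
have step (J' : {set 'I_n}) : (forall j, j \in k :: s -> j \notin J') ->
    prob P (box J' A `&` [set w | C (X k w, sumRV s w)]) = prob P (box J' A) *
    prob (distribution P (X k) \x distribution P (sumRV s))%E C.
  move=> sJ'; apply: prob_indep_pair => //; first exact: measurable_box.
  move=> A0 B0 mA0 mB0.
  pose A' i := if i == k then A0 else A i.
  have mA' i : measurable (A' i) by rewrite /A'; case: ifP.
  have kJ' : k \notin J' by apply: sJ'; rewrite mem_head.
  have AA' i : i \in J' -> A' i = A i.
    by rewrite /A'; case: eqP => // -> kJ; rewrite kJ in kJ'.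
  have boxE : box (k |: J') A' = box J' A `&` X k @^-1` A0.
    apply/seteqP; split=> [w Hw|w [Hw Hk] i /=].
      split=> [i /= iJ|].
        by rewrite -AA'//; apply: Hw; rewrite /= in_setU1 iJ orbT.
      by have := Hw k; rewrite /= /A' eqxx; apply; rewrite in_setU1 eqxx.
    rewrite in_setU1 => /predU1P[->|iJ]; first by rewrite /A' eqxx.
    by rewrite AA'//; exact: Hw.
  rewrite setIA -boxE IH//; last first.
    move=> j js; rewrite in_setU1 negb_or sJ' ?inE ?js ?orbT// andbT.
    by apply: contraNneq ks => <-.
  rewrite mulrA; congr (_ * _).
  rewrite prob_box// big_setU1//= /A' eqxx mulrC; congr (_ * _).
  rewrite prob_box//; apply: eq_bigr => i iJ.
  by rewrite -/(A' i) AA'.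
have sumE : sumRV (k :: s) @^-1` B = [set w | C (X k w, sumRV s w)].
  by apply/seteqP; split=> w; rewrite /C /= big_cons.
rewrite sumE step//; congr (_ * _).
have := step finset.set0; rewrite (_ : box finset.set0 A = setT) ?setTI ?probT ?mul1r.
  by move=> ->// j _; rewrite inE.
by apply/seteqP; split=> w // _ i /=; rewrite inE.
Qed.

Lemma sum_indep_two (i j : 'I_n) (s : seq 'I_n) (A B C : set R) :
  i != j -> uniq s -> i \notin s -> j \notin s ->
  measurable A -> measurable B -> measurable C ->
  prob P (sumRV s @^-1` A `&` (X i @^-1` B `&` X j @^-1` C)) =
  prob P (sumRV s @^-1` A) * (prob P (X i @^-1` B) * prob P (X j @^-1` C)).
Proof.
move=> ij us iNs jNs mA mB mC.
pose D k := if k == i then B else C.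
have mD k : measurable (D k) by rewrite /D; case: ifP.
have boxE : X i @^-1` B `&` X j @^-1` C = box [set i; j]%SET D.
  have Dj : D j = C by rewrite /D eq_sym (negbTE ij).
  have Di : D i = B by rewrite /D eqxx.
  apply/seteqP; split=> [w [Bi Cj] k /=|w Hw].
    by rewrite !inE => /orP[] /eqP ->; rewrite ?Di ?Dj.
  by split; [rewrite -Di|rewrite -Dj]; apply: Hw; rewrite /= !inE eqxx ?orbT.
have := @sum_indep_box s [set i; j]%SET D A us _ mD mA.
rewrite setIC boxE => ->; last first.
  move=> k ks; rewrite !inE negb_or; apply/andP; split.
    by apply: contraNneq iNs => <-.
  by apply: contraNneq jNs => <-.
rewrite mulrC prob_box// big_setU1 ?inE//= big_set1 /D eqxx.
by rewrite eq_sym (negbTE ij).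
Qed.

End n_summands.

(** * Characterization of the class *)

Lemma tail_eq_cdf (R : realType) d (T : measurableType d) (P : probability T R)
    (X : {RV P >-> R}) d' (T' : measurableType d') (P' : probability T' R)
    (X' : {RV P' >-> R}) : cdf X = cdf X' ->
  tail (distribution P X) =1 tail (distribution P' X').
Proof. by move=> XX' x; apply: EFin_inj; rewrite !tail_cdf XX'. Qed.

(** Otherwise all summands but one are at most [K] and the remaining one is at
    most [x - L], which leaves the sum at most [x]. *)
Lemma two_large_summands (R : realType) (n : nat) (a : 'I_n.+1 -> R) (K L x : R) :
  0 <= K -> K *+ n.+1 <= L -> x < \sum_(i < n.+1) a i ->
  (forall i, a i <= x - L) -> exists i j, [/\ i != j, K < a i & K < a j].
Proof.
move=> K0 KL xa aL; apply: contrapT => no.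
have [i Hi] : exists i, forall j, j != i -> a j <= K.
  have [[i Ki]|none] := pselect (exists i, K < a i).
    exists i => j ji; rewrite leNgt; apply/negP => Kj; apply: no.
    by exists i, j; rewrite eq_sym.
  by exists ord0 => j _; rewrite leNgt; apply/negP => Kj; apply: none; exists j.
move: xa; rewrite (bigD1 i)//= ltNge => /negP; apply.
apply: (@le_trans _ _ (x - L + K *+ n.+1)); last by rewrite -lerBrDl opprB addrC subrK.
apply: lerD => //; apply: le_trans (ler_sum _ (fun j ji => Hi j ji)) _.
rewrite sumr_const; apply: ler_wpMn2l => //.
by rewrite -[leqRHS]card_ord; exact: max_card.
Qed.

Section classJ_characterization.
Context (R : realType).

(** For [n] summands, group all but the [i]-th and [j]-th into one independent
    term and then give the [j]-th back, which can only increase the sum. *)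
Lemma prob_sum_two_large d (T : measurableType d) (P : probability T R)
    (n : nat) (X : 'I_n -> {RV P >-> R}) (mu : probability R R)
    (K x e : R) (i j : 'I_n) :
  mutually_independent X -> i != j -> 0 <= e ->
  (forall k, prob (distribution P (X k)) `]-oo, 0[ = 0) ->
  (forall k y, tail (distribution P (X k)) y = tail mu y) ->
  (forall y, joint_tail mu mu K y <= e * tail mu y) ->
  prob P [set w | [/\ K < X i w, K < X j w & x < \sum_(k < n) X k w]] <=
  e * prob P [set w | x < \sum_(k < n) X k w].
Proof.
move=> indepX ij e0 neg tailE He.
pose s := [seq k <- index_enum 'I_n | (k != i) && (k != j)].
have sumE w : \sum_(k < n) X k w = sumRV X s w + (X i w + X j w).
  rewrite (bigD1 i)//= (bigD1 j) 1?eq_sym//= big_filter addrA addrC.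
  by [].
have mS (Y : {RV P >-> R}) y : measurable [set w | y < Y w].
  rewrite (_ : [set w | _] = Y @^-1` `]y, +oo[); first exact: measurable_preimage_RV.
  by apply/seteqP; split=> w /=; rewrite in_itv /= andbT.
have us : uniq s by rewrite filter_uniq ?index_enum_uniq.
have iNs : i \notin s by rewrite mem_filter eqxx.
have jNs : j \notin s by rewrite mem_filter eqxx andbF.
have indep A B C := @sum_indep_two _ _ _ _ _ _ indepX i j s A B C ij us iNs jNs.
have Hij y : joint_tail (distribution P (X i)) (distribution P (X j)) K y <=
    e * tail (distribution P (X i)) y.
  rewrite tailE; apply: le_trans (He y).
  rewrite -[leRHS]mul1r -[1]mulr1; apply: joint_tail_dominated => // z;
  by rewrite tailE mul1r.
have -> : [set w | [/\ K < X i w, K < X j w & x < \sum_(k < n) X k w]] =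
  [set w | [/\ K < X i w, K < X j w & x < sumRV X s w + (X i w + X j w)]].
  by apply/seteqP; split=> w /=; rewrite sumE.
apply: le_trans (joint_excess_le x e0 indep Hij) _.
rewrite ler_wpM2l//.
apply: (@le_prob_ae _ _ _ _ _ _ (X j @^-1` `]-oo, 0[)).
- exact: (mS (sumRV X s \+ X i)).
- have -> : [set w | x < \sum_(k < n) X k w] =
      [set w | x < (sumRV X s \+ (X i \+ X j)) w].
    by apply/seteqP; split=> w /=; rewrite sumE.
  exact: (mS (sumRV X s \+ (X i \+ X j))).
- exact: measurable_preimage_RV.
- exact: neg j.
move=> w /= xw; rewrite in_itv /= sumE; have [j0|j0] := ltP (X j w) 0.
  by right.
by left; rewrite addrA; apply: lt_le_trans xw _; rewrite lerDl.
Qed.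

(** Two summands suffice to obtain [single_big_jump], and it implies the defining
    limit for any number [n] of them: when the sum is large without a summand
    close to [x], two summands are large, and each of the at most [n ^ 2] pairs
    contributes a small fraction of the tail of the sum. *)
Lemma classJP d (T : measurableType d) (P : probability T R)
    (X : {RV P >-> R}) : classJ (cdf X) <->
  classF (cdf X) /\ single_big_jump (distribution P X).
Proof.
set mu := distribution P X.
split=> [XJ|[XF sbj]].
  have [XF _] := XJ; split=> //.
  have [_ mu0] := (classFP X).1 XF.
  by apply: single_big_jump_two => //; exact: classJ_two.
split=> // n n2 d' T' P' Y indepY cdfY.
have [_ mu0] := (classFP X).1 XF.
case: n n2 Y indepY cdfY => // n n2 Y indepY cdfY.
have tailY k y : tail (distribution P' (Y k)) y = tail mu y.
  exact/tail_eq_cdf/cdfY.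
have negY k : prob (distribution P' (Y k)) `]-oo, 0[ = 0.
  by have [] := (classFP (Y k)).1 _; rewrite ?cdfY.
have mN k : measurable (Y k @^-1` `]-oo, 0[) by exact: measurable_preimage_RV.
have mY k x : measurable [set w | x < Y k w].
  rewrite (_ : [set w | _] = Y k @^-1` `]x, +oo[); first exact: measurable_preimage_RV.
  by apply/seteqP; split=> w /=; rewrite in_itv /= andbT.
have mS x : measurable [set w | x < \sum_(k < n.+1) Y k w].
  rewrite (_ : [set w | _] = sumRV Y (index_enum 'I_n.+1) @^-1` `]x, +oo[).
    exact: measurable_preimage_RV.
  by apply/seteqP; split=> w /=; rewrite in_itv /= andbT.
pose good K x := [set w | ((x - K)%:E < \big[maxe/-oo]_(k < n.+1) (Y k w)%:E)%E /\
                   x < \sum_(k < n.+1) Y k w].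
have maxE K x w : ((x - K)%:E < \big[maxe/-oo]_(k < n.+1) (Y k w)%:E)%E <->
    exists k, x - K < Y k w.
  split=> [|[k xk]].
    rewrite ltNge => /negP nle; apply: contrapT => none; apply: nle.
    apply/bigmax_leP; split=> [|k _]; first exact: leNye.
    by rewrite lee_fin leNgt; apply/negP => xk; apply: none; exists k.
  rewrite ltNge; apply/negP => /bigmax_leP[_ /(_ k isT)].
  by rewrite lee_fin leNgt xk.
have goodE K x : good K x =
    (\bigcup_(k in [set: 'I_n.+1]) [set w | x - K < Y k w]) `&`
    [set w | x < \sum_(k < n.+1) Y k w].
  apply/seteqP; split=> w /= [].
    by move=> /maxE[k xk] xs; split=> //; exists k.
  by move=> [k _ xk] xs; split=> //; apply/maxE; exists k.
have mG K x : measurable (good K x).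
  by rewrite goodE; apply: measurableI => //; exact: fin_bigcup_measurable.
have S0 x : 0 < prob P' [set w | x < \sum_(k < n.+1) Y k w].
  apply: (lt_le_trans (mu0 x)); rewrite -(tailY ord0).
  apply: (@le_prob_ae _ _ _ _ _ _
    (\bigcup_(k in [set: 'I_n.+1]) Y k @^-1` `]-oo, 0[)) => //.
  - exact: measurable_preimage_RV.
  - exact: fin_bigcup_measurable.
  - apply/eqP; rewrite eq_le prob_ge0 andbT.
    have {2}<- : \sum_(k < n.+1) prob P' (Y k @^-1` `]-oo, 0[) = 0.
      by rewrite big1// => k _; exact: negY.
    apply: prob_le_bigU => //; first exact: fin_bigcup_measurable.
    by move=> w [k _ kw]; exists k; rewrite mem_index_enum.
  move=> w /=; rewrite in_itv /= andbT => xw.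
  have [[k Yk]|nonneg] := pselect (exists k, Y k w < 0).
    by right; exists k => //=; rewrite in_itv.
  left; apply: (lt_le_trans xw); rewrite (bigD1 ord0)//= lerDl sumr_ge0// => k _.
  by rewrite leNgt; apply/negP => Yk; apply: nonneg; exists k.
apply: limf_einf_cvg1 => [K x|e e0].
  rewrite /big_jump_ratio ler_pdivrMr ?mul1r; last exact: S0.
  by apply: le_prob => // [|w []//]; exact: mG.
pose m : R := (#|{: 'I_n.+1 * 'I_n.+1}|)%:R.
have m0 : 0 < m by rewrite ltr0n card_prod card_ord.
have [K' HK'] := sbj _ (divr_gt0 e0 m0).
pose K := Num.max K' 0.
have K0 : 0 <= K by rewrite le_max lexx orbT.
have HK y : joint_tail mu mu K y <= e / m * tail mu y.
  by apply: le_trans (HK' y); rewrite joint_tail_nonincreasing// le_max lexx.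
exists (K *+ n.+1) => L KL; exists 0 => x _.
rewrite /big_jump_ratio -/(good L x) ler_pdivlMr; last exact: S0.
rewrite -/(prob P' _) -/(prob P' _).
pose pair (ij : 'I_n.+1 * 'I_n.+1) :=
  [set w | [/\ K < Y ij.1 w, K < Y ij.2 w & x < \sum_(k < n.+1) Y k w]].
have mpair ij : measurable (pair ij).
  have -> : pair ij = ([set w | K < Y ij.1 w] `&` [set w | K < Y ij.2 w]) `&`
      [set w | x < \sum_(k < n.+1) Y k w].
    by apply/seteqP; split=> w /=; [case|case=> -[]].
  by do 2?apply: measurableI.
pose S := [set w | x < \sum_(k < n.+1) Y k w].
have bad : prob P' (S `\` good L x) <=
    \sum_(ij : 'I_n.+1 * 'I_n.+1 | ij.1 != ij.2) prob P' (pair ij).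
  apply: prob_le_bigU => //.
    by apply: measurableD; [exact: mS|exact: mG].
  move=> w [/= xS ngood].
  have [k|i [j [ij Ki Kj]]] := two_large_summands K0 KL xS.
    rewrite leNgt; apply/negP => xk; apply: ngood; split=> //.
    by apply/maxE; exists k.
  by exists (i, j); rewrite mem_index_enum.
have : prob P' (S `\` good L x) <= e * prob P' S.
  apply: (le_trans bad).
  apply: (@le_trans _ _ (\sum_(ij : 'I_n.+1 * 'I_n.+1) e / m * prob P' S)).
    rewrite big_mkcond/=; apply: ler_sum => ij _; case: ifPn => [nij|_].
      by apply: prob_sum_two_large indepY nij _ negY tailY HK; rewrite divr_ge0// ltW.
    by rewrite mulr_ge0 ?prob_ge0// divr_ge0// ltW.
  by rewrite sumr_const -mulr_natr -/m mulrAC divfK// gt_eqF.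
rewrite prob_setD; [|exact: mS|exact: mG|by move=> w []].
by rewrite mulrBl mul1r => h; rewrite lerBlDr -lerBlDl.
Qed.

End classJ_characterization.

(** * Sum, maximum and minimum of two independent variables *)

Section two_independent.
Context d (T : measurableType d) (R : realType) (P : probability T R).
Variables X Y : {RV P >-> R}.
Hypothesis indepXY : independent X Y.

Local Notation mu := (distribution P X).
Local Notation nu := (distribution P Y).

Lemma prob_independent (A B : set R) : measurable A -> measurable B ->
  prob P (X @^-1` A `&` Y @^-1` B) = prob mu A * prob nu B.
Proof.
move=> mA mB; apply: EFin_inj; rewrite EFinM !probE//; first exact: indepXY.
by apply: measurableI; exact: measurable_preimage_RV.
Qed.

Lemma tail_sum x :
  tail (distribution P (X \+ Y : {RV P >-> R})) x = conv_tail mu nu x.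
Proof.
have mX : measurable_fun setT X by [].
have mY : measurable_fun setT Y by [].
have := @prob_indep_pair R _ _ _ T R R P mu nu X Y setT measurableT mX mY.
move=> /(_ _ _ (measurable_sum_gt x)); rewrite probT mul1r setTI /conv_tail.
move=> <- //; last by move=> A B mA mB; rewrite setTI mul1r prob_independent.
congr (fine (P _)); apply/seteqP; split=> w;
by rewrite /sum_gt /= in_itv /= andbT.
Qed.

Lemma tail_min x :
  tail (distribution P (X \min Y : {RV P >-> R})) x = tail mu x * tail nu x.
Proof.
rewrite -prob_independent//; congr (fine (P _)).
by apply/seteqP; split=> w /=; rewrite !in_itv /= !andbT lt_min => /andP.
Qed.

Lemma tail_max_ge x :
  tail mu x <= tail (distribution P (X \max Y : {RV P >-> R})) x /\
  tail nu x <= tail (distribution P (X \max Y : {RV P >-> R})) x.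
Proof.
by split; apply: (@le_prob _ _ _ P); try exact: measurable_preimage_RV;
  move=> w /=; rewrite !in_itv /= !andbT lt_max => ->; rewrite ?orbT.
Qed.

Lemma tail_max_le x :
  tail (distribution P (X \max Y : {RV P >-> R})) x <= tail mu x + tail nu x.
Proof.
apply: (@prob_leU _ _ _ P); try exact: measurable_preimage_RV.
by move=> w /=; rewrite !in_itv /= !andbT lt_max => /orP.
Qed.

Lemma tail_sum_ge x :
  prob mu `]-oo, 0[ = 0 -> prob nu `]-oo, 0[ = 0 ->
  tail mu x <= tail (distribution P (X \+ Y : {RV P >-> R})) x /\
  tail nu x <= tail (distribution P (X \+ Y : {RV P >-> R})) x.
Proof.
move=> X0 Y0; split.
  apply: (@le_prob_ae _ _ _ P _ _ (Y @^-1` `]-oo, 0[)) => //;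
    try exact: measurable_preimage_RV.
  move=> w /=; rewrite !in_itv /= !andbT => Xw.
  by case: (ltP (Y w) 0) => ?; [right|left; rewrite (lt_le_trans Xw)// lerDl].
apply: (@le_prob_ae _ _ _ P _ _ (X @^-1` `]-oo, 0[)) => //;
  try exact: measurable_preimage_RV.
move=> w /=; rewrite !in_itv /= !andbT => Xw.
by case: (ltP (X w) 0) => ?; [right|left; rewrite (lt_le_trans Xw)// lerDr].
Qed.

(** On two independent copies of the pair, if both minima exceed [K] and their
    sum exceeds [x], then so do both copies of [X] and both copies of [Y]; these
    two events are independent. *)
Lemma joint_tail_min K x (m := distribution P (X \min Y : {RV P >-> R})) :
  joint_tail m m K x <= joint_tail mu mu K x * joint_tail nu nu K x.
Proof.
pose Z : {RV P >-> R} := X \min Y.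
pose PP : probability (T * T)%type R := (P \x P)%E.
have copy (V : {RV P >-> R}) : measurable_fun setT (fun w : T * T => V w.1) /\
    measurable_fun setT (fun w : T * T => V w.2).
  split; first exact: measurableT_comp (_ : measurable_fun setT V) measurable_fst.
  exact: measurableT_comp (_ : measurable_fun setT V) measurable_snd.
have [mX1 mX2] := copy X; have [mY1 mY2] := copy Y; have [mZ1 mZ2] := copy Z.
have mB := measurable_both_gt K x.
have rect A B C D : measurable A -> measurable B -> measurable C ->
    measurable D ->
    prob PP (((fun w => X w.1) @^-1` A `&` (fun w => X w.2) @^-1` B) `&`
      ((fun w => Y w.1) @^-1` C `&` (fun w => Y w.2) @^-1` D)) =
    (prob mu A * prob mu B) * (prob nu C * prob nu D).
  move=> mA mB' mC mD.
  rewrite mulrACA -!prob_independent// -prob_product.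
  - by congr prob; apply/seteqP; split=> -[a b] /= [[? ?] [? ?]].
  - by apply: measurableI; exact: measurable_preimage_RV.
  - by apply: measurableI; exact: measurable_preimage_RV.
have mm (V : {RV P >-> R}) (E : set (R * R)) : measurable E ->
    measurable [set w : T * T | E (V w.1, V w.2)].
  move=> mE; have [mV1 mV2] := copy V.
  have mf : measurable_fun setT (fun w : T * T => (V w.1, V w.2)).
    exact: measurable_fun_pair.
  by rewrite -[X in measurable X]setTI; exact: mf.
have ZZ : joint_tail m m K x =
    prob PP [set w | both_gt K x (Z w.1, Z w.2)].
  have := @prob_indep_pair R _ _ _ _ R R PP m m (fun w => Z w.1)
    (fun w => Z w.2) setT measurableT mZ1 mZ2.
  move=> /(_ _ _ mB); rewrite probT mul1r setTI => -> //.
  move=> A B mA mB'; rewrite setTI mul1r.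
  rewrite -[RHS]/(prob P (Z @^-1` A) * prob P (Z @^-1` B)) -prob_product.
  - by congr prob; apply/seteqP; split=> -[a b].
  - exact: (measurable_preimage_RV Z).
  - exact: (measurable_preimage_RV Z).
rewrite ZZ; apply: (@le_trans _ _ (prob PP
  ([set w | both_gt K x (X w.1, X w.2)] `&`
   [set w | both_gt K x (Y w.1, Y w.2)]))).
  apply: le_prob; [exact: mm|by apply: measurableI; exact: mm|].
  move=> [w w']; rewrite /both_gt /Z /= !lt_min.
  move=> [/andP[a b] /andP[a' b'] s]; split; split=> //.
    by apply: (lt_le_trans s); rewrite lerD// ge_min lexx.
  by apply: (lt_le_trans s); rewrite lerD// ge_min lexx orbT.
rewrite le_eqVlt; apply/orP; left; apply/eqP.
have YY A B : measurable A -> measurable B ->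
    prob PP ([set w | both_gt K x (X w.1, X w.2)] `&`
      ((fun w => Y w.1) @^-1` A `&` (fun w => Y w.2) @^-1` B)) =
    joint_tail mu mu K x * (prob nu A * prob nu B).
  move=> mA mB'; rewrite setIC mulrC.
  have YY0 : prob PP ((fun w => Y w.1) @^-1` A `&` (fun w => Y w.2) @^-1` B) =
      prob nu A * prob nu B.
    have := rect setT setT A B measurableT measurableT mA mB'.
    by rewrite !preimage_setT !setTI !probT !mul1r.
  rewrite -YY0; apply: (prob_indep_pair _ mX1 mX2) => //.
    by apply: measurableI; rewrite -[X in measurable X]setTI; [exact: mY1|exact: mY2].
  by move=> C D mC mD; rewrite setIC rect// YY0 mulrC.
have XXb : prob PP [set w | both_gt K x (X w.1, X w.2)] = joint_tail mu mu K x.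
  have := YY setT setT measurableT measurableT.
  by rewrite !preimage_setT !setIT !probT !mulr1.
rewrite -XXb; apply: (prob_indep_pair _ mY1 mY2) => //; first exact: mm.
by move=> A B mA mB'; rewrite YY// XXb.
Qed.

End two_independent.

(** * The closure properties *)

Theorem proposition12 (R : realType)
  (d : measure_display) (T : measurableType d) (P : probability T R)
  (X Y : {RV P >-> R})
  (d' : measure_display) (T' : measurableType d') (P' : probability T' R)
  (Z : {RV P' >-> R})
  (F G : R -> \bar R) (p : R)
  (hXY : independent X Y)
  (hX : cdf X = F) (hY : cdf Y = G)
  (hF : classF F) (hG : classF G)
  (hp : 0 < p < 1)
  (hZ : cdf Z = (fun x => p%:E * F x + (1 - p)%:E * G x)%E) :
  (classJ (cdf X) -> classJ (cdf Y) ->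
    (classJ (cdf (X \max Y : {RV P >-> R})) <->
     classJ (cdf (X \+ Y : {RV P >-> R}))) /\
    (classJ (cdf (X \+ Y : {RV P >-> R})) <-> classJ (cdf Z))) /\
  (classJ (cdf X) -> classJ (cdf Y) ->
    classJ (cdf (X \min Y : {RV P >-> R}))).
Proof.
have [p0 p1] := andP hp; have q0 : 0 < 1 - p by rewrite subr_gt0.
have XF : classF (cdf X) by rewrite hX.
have YF : classF (cdf Y) by rewrite hY.
have [Xneg Xpos] := (classFP X).1 XF; have [Yneg Ypos] := (classFP Y).1 YF.
set mu := distribution P X in Xneg Xpos.
set nu := distribution P Y in Yneg Ypos.
pose M : {RV P >-> R} := X \max Y.
pose S : {RV P >-> R} := X \+ Y.
pose N : {RV P >-> R} := X \min Y.
have neg (V : {RV P >-> R}) : (forall w, V w < 0 -> X w < 0 \/ Y w < 0) ->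
    prob (distribution P V) `]-oo, 0[ = 0.
  move=> H; apply/eqP; rewrite eq_le prob_ge0 andbT.
  apply: (@le_trans _ _ (prob mu `]-oo, 0[ + prob nu `]-oo, 0[)); last first.
    by rewrite Xneg Yneg addr0.
  apply: (@prob_leU _ _ _ P);
    try exact: measurable_preimage_RV.
  by move=> w /=; rewrite !in_itv /=; exact: H.
have MF : classF (cdf M).
  apply/classFP; split; last first.
    by move=> x; apply: lt_le_trans (Xpos x) _; have [] := tail_max_ge X Y x.
  by apply: neg => w; rewrite gt_max => /andP[]; left.
have SF : classF (cdf S).
  apply/classFP; split; last first.
    move=> x; apply: lt_le_trans (Xpos x) _.
    by have [] := @tail_sum_ge _ _ _ _ X Y x Xneg Yneg.
  apply: neg => w /= s; have [X0|] := ltP (X w) 0; first by left.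
  have [Y0|Y0 X0] := ltP (Y w) 0; first by right.
  by move: s; rewrite ltNge addr_ge0.
have NF : classF (cdf N).
  apply/classFP; split; last by move=> x; rewrite tail_min// mulr_gt0.
  by apply: neg => w; rewrite gt_min => /orP.
have tailZ x : tail (distribution P' Z) x = p * tail mu x + (1 - p) * tail nu x.
  have cE (V : {RV P >-> R}) : cdf V x = (1 - tail (distribution P V) x)%:E.
    by rewrite EFinB tail_cdf; apply/esym; rewrite -ccdf_1_cdf -cdf_1_ccdf.
  apply: EFin_inj; rewrite tail_cdf hZ -hX -hY !cE -/mu -/nu.
  transitivity ((1 - (p * (1 - tail mu x) + (1 - p) * (1 - tail nu x)))%:E) => //.
  by congr EFin; ring.
have ZF : classF (cdf Z).
  apply/classFP; split; last first.
    by move=> x; rewrite tailZ addr_gt0// mulr_gt0.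
  apply: cdf_neg_null => r r0.
  have cdf0 (V : {RV P >-> R}) : prob (distribution P V) `]-oo, 0[ = 0 ->
      cdf V r = 0%E.
    move=> V0; apply/eqP; rewrite eq_le measure_ge0 andbT.
    rewrite -[leRHS]/(0%:E) -V0 probE// le_measure ?inE//.
    by move=> z /=; rewrite !in_itv /= => /le_lt_trans; apply.
  by rewrite hZ -hX -hY !cdf0// !mule0 adde0.
split=> [/classJP[_ XJ] /classJP[_ YJ]|/classJP[_ XJ] /classJP[_ YJ]].
  have equiv d1 (T1 : measurableType d1) (P1 : probability T1 R)
      (V : {RV P1 >-> R}) (c C : R) : 0 <= c -> 0 <= C -> classF (cdf V) ->
      (forall x, tail (distribution P1 V) x <= C * (tail mu x + tail nu x)) ->
      (forall x, tail mu x + tail nu x <= c * tail (distribution P1 V) x) ->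
      classJ (cdf V) <-> classJ (cdf S).
    move=> c0 C0 VF VC Vc.
    have [VS SV] := @single_big_jump_sum _ mu nu (distribution P1 V)
      (distribution P S) c C c0 C0 Xpos Ypos XJ YJ
      (fun x => (tail_sum_ge x Xneg Yneg).1) (fun x => (tail_sum_ge x Xneg Yneg).2)
      (tail_sum hXY) VC Vc.
    by split=> /classJP[_ J]; apply/classJP; split=> //; [exact: VS|exact: SV].
  split.
    apply: (equiv _ _ _ M 2 1) => // x.
      by rewrite mul1r; exact: tail_max_le.
    by rewrite mulrDl mul1r; have [h1 h2] := tail_max_ge X Y x; exact: lerD.
  apply: iff_sym; pose r := Num.min p (1 - p).
  have r0 : 0 < r by rewrite lt_min p0.
  apply: (equiv _ _ _ Z r^-1 1) => // [|x|x]; first by rewrite invr_ge0 ltW.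
    by rewrite tailZ mul1r lerD// ler_piMl ?tail_ge0// ?gerBl ltW.
  rewrite mulrC ler_pdivlMr// tailZ mulrDl ![_ * r]mulrC.
  by apply: lerD; rewrite ler_wpM2r ?tail_ge0// ge_min lexx ?orbT.
apply/classJP; split=> // e e0.
have [K HK] := XJ _ e0; have [L HL] := YJ 1 ltr01.
exists (Num.max K L) => x; apply: le_trans (joint_tail_min hXY _ _) _.
rewrite tail_min// mulrA; apply: ler_pM; rewrite ?prob_ge0//.
  apply: le_trans (HK x); rewrite joint_tail_nonincreasing// le_max lexx//.
apply: le_trans (_ : _ <= 1 * tail nu x) _; last by rewrite mul1r.
apply: le_trans (HL x); rewrite joint_tail_nonincreasing// le_max lexx orbT//.
Qed.
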